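(* Let $n \ge 2$ be an integer and let $(a_1,b_1),(a_1,b_2),(a_2,b_3),(a_2,b_4)$ be four distinct elements of $[n]^2$ with $a_1\neq a_2$. Then the involution $u := ((a_1,b_1),(a_1,b_2))\,((a_2,b_3),(a_2,b_4)) \in S([n]^2)$ (the product of two disjoint transpositions, the first exchanging $(a_1,b_1)$ and $(a_1,b_2)$, the second exchanging $(a_2,b_3)$ and $(a_2,b_4)$, all other elements of $[n]^2$ being fixed) is stable of rank $1$ if and only if one of the following conditions is satisfied: (i) $\{a_1,a_2\}\cap\{b_1,b_2,b_3,b_4\}=\emptyset$; (ii) $\{a_1,a_2\}=\{b_1,b_2,b_3,b_4\}$.
   Context: Notation: $[n]:=\{1,2,\dots,n\}$; $[n]^t$ is the cartesian product of $t$ copies of $[n]$; $S([n]^t)$ is the symmetric group on the set $[n]^t$; products of permutations are compositions, the rightmost factor being applied first. Tensor product: for $u\in S([n]^t)$ and $v\in S([n]^r)$, the permutation $u\otimes v\in S([n]^{t+r})$ is defined by $(u\otimes v)(\alpha,\beta):=(u(\alpha),v(\beta))$ for all $\alpha\in[n]^t$, $\beta\in[n]^r$. Let $1$ denote the identity of $S([n])$, and write $1^{\otimes m}$ for $1\otimes\cdots\otimes 1$ with $m$ factors (when $m=0$ the factor is omitted). For $u\in S([n]^t)$ define permutations $\Psi_k(u)\in S([n]^{t+k})$, $k\ge 0$, by $\Psi_0(u):=u^{-1}$ and, for $k\ge 1$, $$\Psi_k(u):=\prod_{i=0}^{k}\left(1^{\otimes (k-i)}\otimes u^{-1}\otimes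 1^{\otimes i}\right)\ \prod_{i=1}^{k}\left(1^{\otimes i}\otimes u\otimes 1^{\otimes (k-i)}\right),$$ where in each product the factors are written from left to right in order of increasing $i$. Stability and rank: $u$ is called stable if there is an integer $k\ge 1$ such that $\Psi_{k+l}(u)=\Psi_{k-1}(u)\otimes 1^{\otimes(l+1)}$ for all integers $l\ge 0$; the least such $k$ is called the rank of $u$. ''Stable of rank $1$'' means stable with rank equal to $1$. *)

(* Defs.v *)
From mathcomp Require Import all_boot all_fingroup.

Set Implicit Arguments.
Unset Strict Implicit.
Unset Printing Implicit Defensive.

(* [n] is represented by 'I_n = {0, .., n-1}, and [n]^t by t.-tuple 'I_n. *)
Notation word n t := (t.-tuple 'I_n).

(* Functional composition, rightmost factor first; the product s * t of
   {perm T} applies s first. *)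
Definition compp (T : finType) (s t : {perm T}) : {perm T} := (t * s)%g.

Lemma comppE (T : finType) (s t : {perm T}) x : compp s t x = s (t x).
Proof. by rewrite /compp permM. Qed.

Section Tensor.
Variable n : nat.

Definition wleft t r (x : word n (t + r)) : word n t :=
  [tuple tnth x (lshift r i) | i < t].
Definition wright t r (x : word n (t + r)) : word n r :=
  [tuple tnth x (rshift t i) | i < r].

Lemma wleft_cat t r (a : word n t) (b : word n r) : wleft [tuple of a ++ b] = a.
Proof. by apply: eq_from_tnth => i; rewrite tnth_mktuple tnth_lshift. Qed.

Lemma wright_cat t r (a : word n t) (b : word n r) :
  wright [tuple of a ++ b] = b.
Proof. by apply: eq_from_tnth => i; rewrite tnth_mktuple tnth_rshift. Qed.

Lemma wcatK t r (x : word n (t + r)) : [tuple of wleft x ++ wright x] = x.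
Proof.
apply: eq_from_tnth => i; case: (split_ordP i) => j ->.
  by rewrite tnth_lshift tnth_mktuple.
by rewrite tnth_rshift tnth_mktuple.
Qed.

Definition tens_fun t r (u : {perm word n t}) (v : {perm word n r})
    (x : word n (t + r)) : word n (t + r) :=
  [tuple of u (wleft x) ++ v (wright x)].

Lemma tens_fun_inj t r (u : {perm word n t}) (v : {perm word n r}) :
  injective (tens_fun u v).
Proof.
move=> x y e; rewrite -[x]wcatK -[y]wcatK.
have := congr1 (@wleft t r) e; rewrite !wleft_cat => /perm_inj ->.
by have := congr1 (@wright t r) e; rewrite !wright_cat => /perm_inj ->.
Qed.

Definition tens t r (u : {perm word n t}) (v : {perm word n r}) :
    {perm word n (t + r)} := perm (@tens_fun_inj t r u v).

Lemma tensE t r (u : {perm word n t}) (v : {perm word n r})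
    (a : word n t) (b : word n r) :
  tens u v [tuple of a ++ b] = [tuple of u a ++ v b].
Proof. by rewrite permE /tens_fun wleft_cat wright_cat. Qed.

Lemma tens1 t r : tens (1%g : {perm word n t}) (1%g : {perm word n r}) = 1%g.
Proof. by apply/permP=> x; rewrite -[x]wcatK tensE !perm1. Qed.

(* The m-th tensor power of the identity of S([n]). *)
Fixpoint onepow m : {perm word n m} :=
  if m is m'.+1 then tens (1%g : {perm word n 1}) (onepow m') else 1%g.

Lemma onepowE m : onepow m = 1%g.
Proof. by elim: m => //= m ->; exact: (tens1 1 m). Qed.

(* Transport along an equality of lengths, needed since e.g. (k - i) + t + i
   and t + k are equal but not convertible. *)
Definition cast_wperm s t (e : s = t) (u : {perm word n s}) :
  {perm word n t} := ecast m {perm word n m} e u.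

Lemma cast_wpermE s t (e : s = t) (u : {perm word n s}) x :
  cast_wperm e u x = tcast e (u (tcast (esym e) x)).
Proof. by case: t / e x. Qed.

Lemma pad_r_len t k (i : 'I_k.+1) : (k - i) + t + i = t + k.
Proof. by rewrite addnAC subnK 1?addnC // -ltnS. Qed.

Lemma pad_l_len t k (i : 'I_k.+1) : i + t + (k - i) = t + k.
Proof. by rewrite addnAC subnKC 1?addnC // -ltnS. Qed.

Lemma stab_len t k l : (t + k) + l.+1 = t + (k.+1 + l).
Proof. by rewrite -addnA addSnnS. Qed.

(* bigop is a right fold, so the factors are composed from left to right in
   order of increasing i. *)
Definition Psi t (u : {perm word n t}) (k : nat) : {perm word n (t + k)} :=
  match k return {perm word n (t + k)} with
  | 0 => cast_wperm (esym (addn0 t)) (u^-1)%g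
  | k'.+1 =>
    let k := k'.+1 in
    compp
      (\big[@compp _/1%g]_(i < k.+1)
         cast_wperm (pad_r_len t i)
           (tens (tens (onepow (k - i)) (u^-1)%g) (onepow i)))
      (\big[@compp _/1%g]_(i < k.+1 | 0 < i)
         cast_wperm (pad_l_len t i)
           (tens (tens (onepow i) u) (onepow (k - i))))
  end.

(* The index k >= 1 is written k'.+1, so that Psi u k' is Psi_(k-1)(u). *)
Definition stable_at t (u : {perm word n t}) (k : nat) : Prop :=
  if k is k'.+1 then
    forall l : nat, Psi u (k'.+1 + l) =
      cast_wperm (stab_len t k' l) (tens (Psi u k') (onepow l.+1))
  else False.

Definition stable t (u : {perm word n t}) : Prop := exists k, stable_at u k.

Definition has_rank t (u : {perm word n t}) (r : nat) : Prop :=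
  stable_at u r /\ forall k, stable_at u k -> r <= k.

End Tensor.

(* Main.v *)
Require Import Defs.
From mathcomp Require Import all_boot all_fingroup.

(* Write u_i for u acting on the letters i+1, ..., i+t of a word of length
   t + k.  The two products defining Psi_k(u) telescope into the conjugate of
   u_0^-1 by u_1 ... u_k, so u is stable of rank 1 as soon as u_0 commutes with
   every u_i.  If moreover t = 2 and u(a, b) = (a, s_a(b)), then u_0 commutes
   with every u_i if and only if it commutes with u_1, if and only if
   s_(s_x(y)) = s_y for all x, y.  For the involution of the theorem this means
   s_b1 = s_b2 and s_b3 = s_b4, where s_a1 = (b1 b2), s_a2 = (b3 b4) and
   s_x = 1 for every other x. *)

Set Implicit Arguments.
Unset Strict Implicit.
Unset Printing Implicit Defensive.

(** * Permutations of words as maps on sequences *)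

Section Words.
Variable n : nat.
Implicit Types s : seq 'I_n.

(* Letting permutations of words act on bare sequences makes all the transports
   along equalities of lengths invisible. *)
Definition seq_act t (u : {perm word n t}) s : seq 'I_n :=
  if insub s is Some w then val (u w) else s.

Lemma seq_act_val t (u : {perm word n t}) (w : word n t) :
  seq_act u w = u w.
Proof. by rewrite /seq_act valK. Qed.

Lemma size_seq_act t (u : {perm word n t}) s : size (seq_act u s) = size s.
Proof.
by rewrite /seq_act; case: insubP => [w _ <-|//]; rewrite !size_tuple.
Qed.

Lemma seq_act1 t s : seq_act (1%g : {perm word n t}) s = s.
Proof. by rewrite /seq_act; case: insubP => [w _ <-|//]; rewrite perm1. Qed.

Lemma seq_actM t (u v : {perm word n t}) s :
  seq_act (u * v)%g s = seq_act v (seq_act u s).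
Proof.
rewrite [seq_act (u * v)%g s]/seq_act [seq_act u s]/seq_act.
by case: insubP => [w _ _|sP]; rewrite ?permM ?seq_act_val ?/seq_act ?insubN.
Qed.

Lemma seq_act_inj t (u v : {perm word n t}) :
  (forall s, size s = t -> seq_act u s = seq_act v s) -> u = v.
Proof.
move=> uv; apply/permP => w; apply: val_inj.
by rewrite /= -!seq_act_val; apply: uv; rewrite size_tuple.
Qed.

Lemma seq_act_cast t r (e : t = r) (u : {perm word n t}) :
  seq_act (cast_wperm e u) =1 seq_act u.
Proof. by case: r / e. Qed.

Lemma seq_act_tens t r (u : {perm word n t}) (v : {perm word n r}) s :
  size s = t + r ->
  seq_act (tens u v) s = seq_act u (take t s) ++ seq_act v (drop t s).
Proof.
move=> /eqP size_s; pose w : word n (t + r) := Tuple size_s.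
rewrite -[s]/(val w) -[w]wcatK seq_act_val tensE take_size_cat ?size_tuple //.
by rewrite drop_size_cat ?size_tuple // !seq_act_val.
Qed.

Lemma castV t r (e : t = r) (u : {perm word n t}) :
  cast_wperm e (u^-1)%g = ((cast_wperm e u)^-1)%g.
Proof. by case: r / e. Qed.

Lemma tensV t r (u : {perm word n t}) (v : {perm word n r}) :
  tens (u^-1)%g (v^-1)%g = ((tens u v)^-1)%g.
Proof.
apply/permP => x; apply: (@perm_inj _ (tens u v)).
by rewrite permKV -{1}[x]wcatK !tensE !permKV wcatK.
Qed.

(** * Translates of a permutation and stability of rank 1 *)

Section Slots.
Variables (t k : nat) (u : {perm word n t}).

Definition slot (i : 'I_k.+1) : {perm word n (t + k)} :=
  cast_wperm (pad_l_len t i) (tens (tens (onepow n i) u) (onepow n (k - i))).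

Lemma seq_act_slot (i : 'I_k.+1) s : size s = t + k ->
  seq_act (slot i) s =
    take i s ++ seq_act u (take t (drop i s)) ++ drop (i + t) s.
Proof.
move=> size_s; have size_s' := etrans size_s (esym (pad_l_len t i)).
rewrite seq_act_cast !onepowE seq_act_tens // seq_act_tens.
  by rewrite !seq_act1 take_takel ?leq_addr // addnC -take_drop catA.
by rewrite size_take size_s' ltn_neqAle leq_addr andbT; case: eqP.
Qed.

(* The r-th factor of the first product in Psi carries its identity block on
   the other side, hence is the inverse of the slot at [rev_ord r]. *)
Lemma slot_rev (i : 'I_k.+1) :
  cast_wperm (pad_r_len t i)
    (tens (tens (onepow n (k - i)) (u^-1)%g) (onepow n i)) =
  ((slot (rev_ord i))^-1)%g.
Proof.
rewrite -castV -tensV -tensV /= !onepowE !invg1.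
(* With the length proofs generalised, [k - (k - i)] can be rewritten to [i] under the cast. *)
move: (pad_r_len t i) (pad_l_len t (rev_ord i)) => /=.
rewrite subSS subKn -1?ltnS // => e e'.
by rewrite (eq_irrelevance e e').
Qed.

End Slots.

(** [compp] is opposite to the group law, and inversion is a morphism from one to the other. *)
Lemma big_comppE (T I : finType) (P : pred I) (F : I -> {perm T}) :
  \big[@compp T/1%g]_(i | P i) F i = ((\prod_(i | P i) (F i)^-1)^-1)%g.
Proof.
rewrite (big_morph _ (fun x y => invMg x y : _ = compp x^-1 y^-1)%g (invg1 _)).
by apply: eq_bigr => i _; rewrite invgK.
Qed.

Lemma prod_rev_ord (gT : finGroupType) m (F : 'I_m -> gT) :
  (\prod_(i < m) F (rev_ord i) = (\prod_(i < m) (F i)^-1)^-1)%g.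
Proof.
elim: m F => [|m IHm] F; first by rewrite !big_ord0 invg1.
rewrite big_ord_recr big_ord_recl /= invMg invgK -IHm.
congr (_ * F _)%g; last by apply: val_inj; rewrite /= subnn.
apply: eq_bigr => i _; congr (F _); apply: val_inj => /=.
by rewrite /bump subSS add1n subnSK.
Qed.

(** Let P be the group product of the inverse slots of positive index. The first product of [Psi] is
    the inverse of slot 0 times P; the second, applied first, is the inverse of P. *)
Lemma Psi_conj t (u : {perm word n t}) k :
  Psi u k.+1 =
  (((slot u ord0)^-1) ^ (\prod_(i < k.+1) (slot u (lift ord0 i))^-1))%g.
Proof.
rewrite /Psi (eq_bigr _ (fun i _ => slot_rev u i)) !big_comppE.
rewrite (eq_bigr (fun i => slot u (rev_ord i))) => [|i _]; last exact: invgK.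
rewrite prod_rev_ord invgK [X in compp X _]big_ord_recl /compp.
by rewrite big_mkcond [X in (X^-1 * _)%g = _]big_ord_recl /= mul1g conjgE.
Qed.

Lemma cast_tens_Psi0 t (u : {perm word n t}) l :
  cast_wperm (stab_len t 0 l) (tens (Psi u 0) (onepow n l.+1)) =
  ((slot u (ord0 : 'I_(1 + l).+1))^-1)%g.
Proof.
rewrite -castV -tensV -tensV !onepowE !invg1; apply: seq_act_inj => s size_s.
rewrite !seq_act_cast !seq_act_tens ?addn0 ?size_takel ?size_s ?leq_addr //.
by rewrite seq_act_cast !seq_act1 /= addn0 take0 drop0.
Qed.

Lemma stable_at1E t (u : {perm word n t}) :
  stable_at u 1 <-> forall k : nat,
    commute (slot u (ord0 : 'I_k.+2))
            (\prod_(i < k.+1) (slot u (lift ord0 i))^-1)%g.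
Proof.
rewrite /stable_at; split=> com k; move: (com k).
  by rewrite cast_tens_Psi0 Psi_conj conjVg => /invg_inj/conjg_fixP/commgP.
by rewrite cast_tens_Psi0 Psi_conj conjVg => /commgP/conjg_fixP->.
Qed.

Lemma has_rank1E t (u : {perm word n t}) :
  (stable u /\ has_rank u 1) <-> stable_at u 1.
Proof.
by split=> [[_ []]//|st]; split; [exists 1 | split=> // -[]].
Qed.

(** * Permutations of two-letter words that fix the first letter *)

Section Skew.
Variables (u : {perm word n 2}) (sg : 'I_n -> {perm 'I_n}).
Hypothesis uE : forall a b, u [tuple a; b] = [tuple a; sg a b].

Lemma nth_slot_skew d k (i : 'I_k.+1) s j : size s = 2 + k ->
  nth d (seq_act (slot u i) s) j =
  if j == i.+1 then sg (nth d s i) (nth d s j) else nth d s j.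
Proof.
move=> size_s; rewrite seq_act_slot //.
have lt_i : i.+1 < size s by rewrite size_s !ltnS leq_ord.
rewrite (drop_nth d (ltnW lt_i)) (drop_nth d lt_i) /= take0.
set x := nth d s i; set y := nth d s i.+1.
rewrite -[[:: x; y]]/(val [tuple x; y]) seq_act_val uE /= addn2.
rewrite nth_cat size_takel; last exact: ltnW (ltnW lt_i).
case: ltnP => [lt_ji|]; first by rewrite nth_take // ltn_eqF // ltnS ltnW.
move=> /subnKC <-; rewrite addKn; case: (j - i) => [|[|m]] /=.
- by rewrite addn0 ltn_eqF.
- by rewrite addn1 eqxx.
- by rewrite nth_drop !addnS gtn_eqF // !ltnS leq_addr.
Qed.

Lemma stable_at1_skew :
  stable_at u 1 <-> forall x y, sg (sg x y) = sg y.
Proof.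
apply: (iff_trans (stable_at1E u)); split=> [com x y | sgK k].
  (* On the word xyz the last letter becomes [sg (sg x y) z] if slot 0 acts first, and [sg y z] if
     slot 1 does. *)
  apply/permP => z; have := com 0; rewrite big_ord1 => /commuteV.
  rewrite invgK => /(congr1 (fun v => nth x (seq_act v [:: x; y; z]) 2)).
  by rewrite !seq_actM !nth_slot_skew ?size_seq_act.
apply: big_ind => [|v w|i _]; [exact: commute1|exact: commuteM|].
apply: commuteV; apply: seq_act_inj => s size_s.
have d : 'I_n by case: s size_s.
apply: (@eq_from_nth _ d) => [|j _]; rewrite !seq_actM ?size_seq_act //.
rewrite !nth_slot_skew ?size_seq_act //= /bump /= add1n.
(* Slot 0 changes only letter 1, under the control of letter 0; the other slot changes only letter
   [i.+2], under the control of letter [i.+1]. The order can matter only when [i.+1] is 1, where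
   [sgK] applies. *)
have [->|j1] := eqVneq j 1; have [//|//] := eqVneq _ i.+2.
by move=> ->; case: eqP => [->|//]; rewrite sgK.
Qed.

End Skew.
End Words.

(** * Transpositions *)

Lemma tperm_tuple2 (T : finType) (a b b' c d : T) :
  tperm [tuple a; b] [tuple a; b'] [tuple c; d] =
  [tuple c; if c == a then tperm b b' d else d].
Proof.
have eq2 e f : ([tuple a; e] == [tuple c; f]) = (c == a) && (f == e).
  by rewrite -val_eqE /= !eqseq_cons andbT eq_sym [e == f]eq_sym.
rewrite !permE /= ![[tuple c; d] == _]eq_sym !eq2.
by case: eqP => [->|_] //=; case: eqP => // _; case: eqP.
Qed.

Lemma tperm_eq1 (T : finType) (x y : T) : (tperm x y == 1%g) = (x == y).
Proof.
apply/eqP/eqP => [/permP/(_ x)|->]; last exact: tperm1.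
by rewrite tpermL perm1.
Qed.

Lemma tperm_supp (T : finType) (x y z w : T) :
  z != w -> tperm x y = tperm z w -> z \in [set x; y].
Proof.
move=> zw /permP/(_ z); rewrite tpermL !inE.
by case: tpermP => [->|->|_ _ /eqP]; rewrite ?eqxx ?orbT // (negPf zw).
Qed.

Lemma tperm_set2 (T : finType) (x y z w : T) :
  z != w -> z \in [set x; y] -> w \in [set x; y] ->
  tperm z w = tperm x y /\ [set z; w] = [set x; y].
Proof.
move=> zw; rewrite !inE => /orP[]/eqP ez /orP[]/eqP ew; subst.
- by rewrite eqxx in zw.
- by [].
- by rewrite tpermC setUC.
- by rewrite eqxx in zw.
Qed.

(** * From the identity on second letters to the conditions on sets *)

Section TwoTranspositions.
Variables (T : finType) (a1 a2 b1 b2 b3 b4 : T).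
Hypotheses (ha : a1 != a2) (hb : b1 != b2) (hb' : b3 != b4).

Definition two_tperm (x : T) : {perm T} :=
  if x == a1 then tperm b1 b2 else if x == a2 then tperm b3 b4 else 1%g.

Lemma two_tperm_eq1 x : (two_tperm x == 1%g) = (x \notin [set a1; a2]).
Proof.
rewrite /two_tperm !inE; case: (x == a1); first by rewrite tperm_eq1 (negPf hb).
by case: (x == a2); rewrite ?tperm_eq1 ?(negPf hb') ?eqxx.
Qed.

Lemma two_tperm_l : two_tperm a1 = tperm b1 b2.
Proof. by rewrite /two_tperm eqxx. Qed.

Lemma two_tperm_r : two_tperm a2 = tperm b3 b4.
Proof. by rewrite /two_tperm eq_sym (negPf ha) eqxx. Qed.

(** The permutations [two_tperm x] move letters only by exchanging [b1] with [b2] or [b3] with [b4],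
    and both exchanges occur, at [a1] and at [a2]. *)
Lemma two_tperm_skew :
  (forall x y, two_tperm (two_tperm x y) = two_tperm y) <->
  two_tperm b1 = two_tperm b2 /\ two_tperm b3 = two_tperm b4.
Proof.
split=> [H | [H H'] x y].
  by have := (H a1 b2, H a2 b4); rewrite two_tperm_l two_tperm_r !tpermR => -[].
rewrite {2}/two_tperm.
by do 2?[case: ifP => _]; rewrite ?perm1 //; case: tpermP => [->|->|].
Qed.

Lemma two_tperm_on :
  two_tperm b1 = two_tperm b2 /\ two_tperm b3 = two_tperm b4 <->
  [set a1; a2] :&: [set b1; b2; b3; b4] = set0 \/
  [set a1; a2] = [set b1; b2; b3; b4].
Proof.
set A := [set a1; a2]; set B := [set b1; b2; b3; b4].
have [B1 B2 B3 B4] : [/\ b1 \in B, b2 \in B, b3 \in B & b4 \in B].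
  by rewrite !inE !eqxx !orbT.
have inA x y : two_tperm x = two_tperm y -> (x \in A) = (y \in A).
  by move=> e; apply: negb_inj; rewrite -!two_tperm_eq1 e.
have onA : tperm b1 b2 = tperm b3 b4 ->
    {in A &, forall x y, two_tperm x = two_tperm y}.
  move=> e; suff sgA x : x \in A -> two_tperm x = tperm b1 b2.
    by move=> x y /sgA-> /sgA->.
  by rewrite !inE /two_tperm; case: eqP => //= _ ->.
(* Both letters lie in the two-element set [A], so they exhaust it; [two_tperm] is then constant on
   [A], and its values at [a1] and [a2] agree. *)
have eq_sg b b' : b != b' -> two_tperm b = two_tperm b' -> b \in A ->
    tperm b1 b2 = tperm b3 b4 /\ [set b; b'] = A.
  move=> bb' e bA; have b'A : b' \in A by rewrite -(inA _ _ e).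
  have [_ bbA] := tperm_set2 bb' bA b'A; split=> //.
  have sgA x : x \in A -> two_tperm x = two_tperm b.
    by rewrite -[A]bbA !inE => /orP[]/eqP->.
  by rewrite -two_tperm_l -two_tperm_r !sgA ?inE ?eqxx ?orbT.
have BE : B = [set b1; b2] :|: [set b3; b4] by rewrite setUA.
have eqB : tperm b1 b2 = tperm b3 b4 -> [set b3; b4] = [set b1; b2].
  move=> e; have [] // := tperm_set2 hb' (tperm_supp hb' e).
  by apply: (@tperm_supp _ _ _ _ b3); rewrite 1?eq_sym // e tpermC.
split=> [[e e'] | [AB0 | AB]].
(* If either pair meets [A], it equals [A] and the two pairs coincide; otherwise [A] and [B] are
   disjoint. *)
- have [b1A|b1A] := boolP (b1 \in A).
    have [/eqB E12 <-] := eq_sg _ _ hb e b1A.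
    by right; rewrite BE E12 setUid.
  have [b3A|b3A] := boolP (b3 \in A).
    have [/eqB E12 <-] := eq_sg _ _ hb' e' b3A.
    by right; rewrite BE E12 setUid.
  left; apply/setP => x; rewrite in_setI in_set0; apply/andP => -[].
  rewrite BE => xA /setUP[]/set2P[] ex; move: xA;
    by rewrite ex -?(inA _ _ e) -?(inA _ _ e') ?(negPf b1A) ?(negPf b3A).
- have out b : b \in B -> two_tperm b = 1%g.
    move=> bB; apply/eqP; rewrite two_tperm_eq1; apply/negP => bA.
    by have := in_set0 b; rewrite -AB0 inE bA bB.
  by rewrite !out.
(* Both transpositions exchange the two elements of [A], hence are equal. *)
- have inBA b : b \in B -> b \in A by rewrite AB.
  have [e _] := tperm_set2 hb (inBA _ B1) (inBA _ B2).
  have [e' _] := tperm_set2 hb' (inBA _ B3) (inBA _ B4).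
  by split; apply: onA; rewrite ?AB // e e'.
Qed.

End TwoTranspositions.

Theorem theorem1p2 (n : nat) (hn : 2 <= n) (a1 a2 b1 b2 b3 b4 : 'I_n)
    (hdist : uniq [:: [tuple a1; b1]; [tuple a1; b2];
                      [tuple a2; b3]; [tuple a2; b4]])
    (ha : a1 != a2) :
  let u : {perm word n 2} :=
    compp (tperm [tuple a1; b1] [tuple a1; b2])
          (tperm [tuple a2; b3] [tuple a2; b4]) in
  (stable u /\ has_rank u 1) <->
  ([set a1; a2] :&: [set b1; b2; b3; b4] = set0 \/
   [set a1; a2] = [set b1; b2; b3; b4]).
Proof.
move=> u.
have uE a b :
    u [tuple a; b] = [tuple a; two_tperm a1 a2 b1 b2 b3 b4 a b].
  rewrite comppE !tperm_tuple2 /two_tperm.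
  have [->|] := eqVneq a a1; first by rewrite (negPf ha).
  by case: (a == a2); rewrite ?perm1.
have neq a b b' : [tuple a; b] != [tuple a; b'] -> b != b'.
  by apply: contraNneq => ->.
move: hdist; rewrite /= !inE !negb_or => /and4P[/andP[/neq hb _] _ /neq hb' _].
apply: iff_trans (has_rank1E u) _; apply: iff_trans (stable_at1_skew uE) _.
exact: iff_trans (two_tperm_skew _ _ _ _ ha) (two_tperm_on ha hb hb').
Qed.
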